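(* Let $\mathcal F$ be a commutative ring, let $(A,[\,,]_A,\rho)$ be a generalized Lie $\mathcal F$-algebra such that $A$ is a free $\mathcal F$-module with basis $\{t_\alpha\}_{\alpha\in\{1,\dots,p\}}$, let $\{t^\alpha\}$ be the dual basis (coframe), and let $L^\gamma_{\alpha\beta}\in\mathcal F$ be the structure elements, $[t_\alpha,t_\beta]_A=L^\gamma_{\alpha\beta}t_\gamma$ (summation over repeated indices). If $d^A$ is the exterior differentiation operator, then the structure equations of Maurer–Cartan type hold: $$d^{A}t^{\alpha}=-\frac12 L^{\alpha}_{\beta\gamma}\,t^{\beta}\wedge t^{\gamma}\qquad\text{for every }\alpha .$$
   Context: Rings are unitary. For a commutative ring $\mathcal F$, $\mathrm{Der}(\mathcal F)$ is the set of additive maps $X:\mathcal F\to\mathcal F$ with $X(fg)=X(f)g+fX(g)$; it is an $\mathcal F$-module via $(fX)(g)=f\cdot X(g)$. A generalized Lie $\mathcal F$-algebra $(A,[\,,]_A,\rho)$ is an $\mathcal F$-module $A$ with an $\mathcal F$-module morphism $\rho:A\to\mathrm{Der}(\mathcal F)$ and a biadditive operation $[\,,]_A:A\times A\to A$ such that, for all $u,v,z\in A$ and $f\in\mathcal F$: $[u,u]_A=0$; $[u,[v,z]_A]_A+[z,[u,v]_A]_A+[v,[z,u]_A]_A=0$; and $[u,fv]_A=f[u,v]_A+\rho(u)(f)\cdot v$. $q$-forms are $\mathcal F$-multilinear maps $A^q\to\mathcal F$ that change by $\mathrm{sgn}(\sigma)$ under permutation $\sigma$ of the arguments. For $1$-forms,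 $(\omega\wedge\theta)(u,v)=\omega(u)\theta(v)-\omega(v)\theta(u)$ and $d^A\theta(u,v)=\rho(u)(\theta(v))-\rho(v)(\theta(u))-\theta([u,v]_A)$. Since both $L^\alpha_{\beta\gamma}$ and $t^\beta\wedge t^\gamma$ are antisymmetric in $\beta,\gamma$, the expression $\frac12L^\alpha_{\beta\gamma}t^\beta\wedge t^\gamma$ (summed over all $\beta,\gamma$) stands for $\sum_{\beta<\gamma}L^\alpha_{\beta\gamma}t^\beta\wedge t^\gamma$. *)

(* Defs.v *)
From HB Require Import structures.
From mathcomp Require Import all_boot all_fingroup all_algebra.
From mathcomp Require Import ring boolp.

Set Implicit Arguments.
Unset Strict Implicit.
Unset Printing Implicit Defensive.

Import GRing.Theory.
Local Open Scope ring_scope.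

(* Rings are [comPzRingType]s, so the zero ring is allowed. The types of
   derivations and of forms get their [choiceType] structure, which modules
   require, from the axioms of [boolp]. *)

Record derivation (F : comPzRingType) := Derivation {
  der_fun :> F -> F;
  derD : {morph der_fun : f g / f + g};
  derM : forall f g, der_fun (f * g) = der_fun f * g + f * der_fun g
}.

Lemma derivation_eq (F : comPzRingType) (X Y : derivation F) : X =1 Y -> X = Y.
Proof.
case: X Y => [X XD XM] [Y YD YM] /= /funext XY.
by rewrite XY in XD XM *; congr Derivation; exact: Prop_irrelevance.
Qed.

HB.instance Definition _ (F : comPzRingType) := gen_eqMixin (derivation F).
HB.instance Definition _ (F : comPzRingType) := gen_choiceMixin (derivation F).

Section DerModule.
Variable F : comPzRingType.
Implicit Types X Y : derivation F.

Program Definition der_zero := @Derivation F (fun=> 0) _ _.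
Next Obligation. by move=> f g; rewrite addr0. Qed.
Next Obligation. by rewrite mul0r mulr0 addr0. Qed.

Program Definition der_opp X := @Derivation F (fun f => - X f) _ _.
Next Obligation. by move=> f g; rewrite derD opprD. Qed.
Next Obligation. by rewrite derM opprD mulNr mulrN. Qed.

Program Definition der_add X Y := @Derivation F (fun f => X f + Y f) _ _.
Next Obligation. by move=> f g; rewrite !derD addrACA. Qed.
Next Obligation. by rewrite !derM mulrDl mulrDr addrACA. Qed.

Program Definition der_scale (a : F) X := @Derivation F (fun f => a * X f) _ _.
Next Obligation. by move=> f g; rewrite derD mulrDr. Qed.
Next Obligation. by rewrite derM mulrDr !mulrA (mulrC a f). Qed.

Fact der_addA : associative der_add.
Proof. by move=> X Y Z; apply: derivation_eq => f /=; rewrite addrA. Qed.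
Fact der_addC : commutative der_add.
Proof. by move=> X Y; apply: derivation_eq => f /=; rewrite addrC. Qed.
Fact der_add0 : left_id der_zero der_add.
Proof. by move=> X; apply: derivation_eq => f /=; rewrite add0r. Qed.
Fact der_addN : left_inverse der_zero der_opp der_add.
Proof. by move=> X; apply: derivation_eq => f /=; rewrite addNr. Qed.

HB.instance Definition _ := GRing.isZmodule.Build (derivation F)
  der_addA der_addC der_add0 der_addN.

Fact der_scaleA a b X : der_scale a (der_scale b X) = der_scale (a * b) X.
Proof. by apply: derivation_eq => f /=; rewrite mulrA. Qed.
Fact der_scale1 : left_id 1 der_scale.
Proof. by move=> X; apply: derivation_eq => f /=; rewrite mul1r. Qed.
Fact der_scaleDr : right_distributive der_scale +%R.
Proof. by move=> a X Y; apply: derivation_eq => f /=; rewrite mulrDr. Qed.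
Fact der_scaleDl X : {morph der_scale^~ X : a b / a + b}.
Proof. by move=> a b; apply: derivation_eq => f /=; rewrite mulrDl. Qed.

HB.instance Definition _ := GRing.Zmodule_isLmodule.Build F (derivation F)
  der_scaleA der_scale1 der_scaleDr der_scaleDl.

End DerModule.

Record gen_lie_alg (F : comPzRingType) (A : lmodType F) := GenLieAlg {
  bracket : A -> A -> A;
  anchor : {linear A -> derivation F};
  bracketDl : forall u v z, bracket (u + v) z = bracket u z + bracket v z;
  bracketDr : forall u v z, bracket u (v + z) = bracket u v + bracket u z;
  bracketuu : forall u, bracket u u = 0;
  jacobi : forall u v z,
    bracket u (bracket v z) + bracket z (bracket u v)
      + bracket v (bracket z u) = 0;
  bracket_leibniz : forall (u v : A) (f : F),
    bracket u (f *: v) = f *: bracket u v + anchor u f *: v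
}.

Lemma bracketC (F : comPzRingType) (A : lmodType F) (G : gen_lie_alg A) u v :
  bracket G u v = - bracket G v u.
Proof.
have := bracketuu G (u + v); rewrite bracketDl !bracketDr !bracketuu add0r addr0.
by move/eqP; rewrite addr_eq0 => /eqP.
Qed.

Definition set_arg (T : Type) (q : nat) (x : q.-tuple T) (i : 'I_q) (u : T) :=
  [tuple if j == i then u else tnth x j | j < q].

Definition perm_args (T : Type) (q : nat) (s : 'S_q) (x : q.-tuple T) :=
  [tuple tnth x (s i) | i < q].

Record qform (F : comPzRingType) (A : lmodType F) (q : nat) := QForm {
  form_fun :> q.-tuple A -> F;
  formP : forall x i (a : F) u v,
    form_fun (set_arg x i (a *: u + v)) =
    a * form_fun (set_arg x i u) + form_fun (set_arg x i v);
  form_perm : forall (s : 'S_q) x,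
    form_fun (perm_args s x) = (-1) ^+ s * form_fun x
}.

Lemma qform_eq (F : comPzRingType) (A : lmodType F) q (w z : qform A q) :
  w =1 z -> w = z.
Proof.
case: w z => [w wP ws] [z zP zs] /= /funext wz.
by rewrite wz in wP ws *; congr QForm; exact: Prop_irrelevance.
Qed.

HB.instance Definition _ (F : comPzRingType) (A : lmodType F) q :=
  gen_eqMixin (qform A q).
HB.instance Definition _ (F : comPzRingType) (A : lmodType F) q :=
  gen_choiceMixin (qform A q).

Section FormModule.
Variables (F : comPzRingType) (A : lmodType F) (q : nat).
Implicit Types w z : qform A q.

Program Definition form_zero := @QForm F A q (fun=> 0) _ _.
Next Obligation. by rewrite mulr0 addr0. Qed.
Next Obligation. by rewrite mulr0. Qed.

Program Definition form_opp w := @QForm F A q (fun x => - w x) _ _.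
Next Obligation. by rewrite formP opprD mulrN. Qed.
Next Obligation. by rewrite form_perm mulrN. Qed.

Program Definition form_add w z := @QForm F A q (fun x => w x + z x) _ _.
Next Obligation. by rewrite !formP mulrDr addrACA. Qed.
Next Obligation. by rewrite !form_perm mulrDr. Qed.

Program Definition form_scale (b : F) w := @QForm F A q (fun x => b * w x) _ _.
Next Obligation. by rewrite formP mulrDr mulrCA. Qed.
Next Obligation. by rewrite form_perm mulrCA. Qed.

Fact form_addA : associative form_add.
Proof. by move=> *; apply: qform_eq => x /=; rewrite addrA. Qed.
Fact form_addC : commutative form_add.
Proof. by move=> *; apply: qform_eq => x /=; rewrite addrC. Qed.
Fact form_add0 : left_id form_zero form_add.
Proof. by move=> *; apply: qform_eq => x /=; rewrite add0r. Qed.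
Fact form_addN : left_inverse form_zero form_opp form_add.
Proof. by move=> *; apply: qform_eq => x /=; rewrite addNr. Qed.

HB.instance Definition _ := GRing.isZmodule.Build (qform A q)
  form_addA form_addC form_add0 form_addN.

Fact form_scaleA a b w : form_scale a (form_scale b w) = form_scale (a * b) w.
Proof. by apply: qform_eq => x /=; rewrite mulrA. Qed.
Fact form_scale1 : left_id 1 form_scale.
Proof. by move=> *; apply: qform_eq => x /=; rewrite mul1r. Qed.
Fact form_scaleDr : right_distributive form_scale +%R.
Proof. by move=> *; apply: qform_eq => x /=; rewrite mulrDr. Qed.
Fact form_scaleDl w : {morph form_scale^~ w : a b / a + b}.
Proof. by move=> *; apply: qform_eq => x /=; rewrite mulrDl. Qed.

HB.instance Definition _ := GRing.Zmodule_isLmodule.Build F (qform A q)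
  form_scaleA form_scale1 form_scaleDr form_scaleDl.

End FormModule.

Section LowDegree.
Variables (F : comPzRingType) (A : lmodType F).
Implicit Types w z : qform A 1.

Definition ev1 w (u : A) : F := w [tuple u].
Definition ev2 (w : qform A 2) (u v : A) : F := w [tuple u; v].

Lemma ev1P w (a : F) (u v : A) : ev1 w (a *: u + v) = a * ev1 w u + ev1 w v.
Proof.
have E y : ev1 w y = w (set_arg [tuple 0] ord0 y).
  by congr (form_fun w _); apply: eq_from_tnth => i; rewrite tnth_mktuple !ord1.
by rewrite !E formP.
Qed.

Lemma ev1_0 w : ev1 w 0 = 0.
Proof. by have := ev1P w (-1) 0 0; rewrite scaleN1r addNr mulN1r addNr. Qed.

Section Form2.
Variable b : A -> A -> F.
Hypothesis b_lin : forall (a : F) (u v y : A), b (a *: u + v) y = a * b u y + b v y.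
Hypothesis bC : forall u v, b v u = - b u v.

Let b2 (x : 2.-tuple A) := b (tnth x ord0) (tnth x ord_max).

Fact form2P x i (a : F) u v :
  b2 (set_arg x i (a *: u + v)) = a * b2 (set_arg x i u) + b2 (set_arg x i v).
Proof.
rewrite /b2 /set_arg !tnth_mktuple; case: i => [[|[|//]] lti] /=.
  by rewrite b_lin.
by rewrite ![b (tnth _ _) _]bC b_lin opprD mulrN.
Qed.

Fact form2_perm (s : 'S_2) x : b2 (perm_args s x) = (-1) ^+ s * b2 x.
Proof.
rewrite /b2 /perm_args !tnth_mktuple.
have o2 (i : 'I_2) : i = ord0 \/ i = ord_max.
  by case: i => [[|[|//]] lti]; [left | right]; apply/val_inj.
have s_neq : s ord0 <> s ord_max by move/perm_inj.
have [s0|s0] := o2 (s ord0); have [s1|s1] := o2 (s ord_max).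
- by case: s_neq; rewrite s0 s1.
- have -> : s = 1%g by apply/permP => i; rewrite perm1; case: (o2 i) => ->.
  by rewrite !perm1 odd_perm1 mul1r.
- have -> : s = tperm ord0 ord_max.
    by apply/permP => i; case: (o2 i) => ->; rewrite ?tpermL ?tpermR.
  by rewrite tpermL tpermR odd_tperm mulN1r bC.
by case: s_neq; rewrite s0 s1.
Qed.

Definition form2 : qform A 2 := QForm form2P form2_perm.

Lemma ev2_form2 u v : ev2 form2 u v = b u v.
Proof. by []. Qed.

End Form2.

Section Wedge.
Variables w z : qform A 1.

Definition wedge_fun (u v : A) : F := ev1 w u * ev1 z v - ev1 w v * ev1 z u.

Fact wedge_lin (a : F) u1 u2 v :
  wedge_fun (a *: u1 + u2) v = a * wedge_fun u1 v + wedge_fun u2 v.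
Proof.
by rewrite /wedge_fun !ev1P mulrDl mulrDr opprD mulrBr -mulrA
  (mulrCA _ a) addrACA.
Qed.

Fact wedgeC u v : wedge_fun v u = - wedge_fun u v.
Proof. by rewrite /wedge_fun opprB. Qed.

Definition wedge : qform A 2 := form2 wedge_lin wedgeC.

Lemma wedgeE u v : ev2 wedge u v = ev1 w u * ev1 z v - ev1 w v * ev1 z u.
Proof. exact: ev2_form2. Qed.

End Wedge.

Section ExteriorDifferential.
Variables (G : gen_lie_alg A) (z : qform A 1).

Definition ext_d_fun (u v : A) : F :=
  anchor G u (ev1 z v) - anchor G v (ev1 z u) - ev1 z (bracket G u v).

Fact ext_dC u v : ext_d_fun v u = - ext_d_fun u v.
Proof.
rewrite /ext_d_fun (bracketC G v u) -[- bracket G u v]addr0 -scaleN1r ev1P.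
by rewrite ev1_0 addr0 mulN1r opprK [RHS]opprB opprB addrC.
Qed.

Fact ext_d_lin (a : F) u1 u2 v :
  ext_d_fun (a *: u1 + u2) v = a * ext_d_fun u1 v + ext_d_fun u2 v.
Proof.
have z1 (c : F) x : ev1 z (c *: x) = c * ev1 z x.
  by rewrite -[c *: x]addr0 ev1P ev1_0 addr0.
have zD x y : ev1 z (x + y) = ev1 z x + ev1 z y.
  by rewrite -[x]scale1r ev1P mul1r scale1r.
have zN x : ev1 z (- x) = - ev1 z x by rewrite -scaleN1r z1 mulN1r.
have rlin x y f : anchor G (a *: x + y) f = a * anchor G x f + anchor G y f.
  by rewrite linearP.
rewrite /ext_d_fun 3!(bracketC G _ v) bracketDr bracket_leibniz rlin !zN.
rewrite ev1P !zD !z1 derD derM.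
by rewrite /=; ring.
Qed.

Definition ext_d : qform A 2 := form2 ext_d_lin ext_dC.

Lemma ext_dE u v : ev2 ext_d u v =
  anchor G u (ev1 z v) - anchor G v (ev1 z u) - ev1 z (bracket G u v).
Proof. exact: ev2_form2. Qed.

End ExteriorDifferential.

End LowDegree.

Definition is_basis (F : comPzRingType) (A : lmodType F) (p : nat)
    (t : 'I_p -> A) : Prop :=
  (forall u : A, exists c : 'I_p -> F, u = \sum_(i < p) c i *: t i) /\
  (forall c : 'I_p -> F, \sum_(i < p) c i *: t i = 0 -> forall i, c i = 0).

Definition is_dual_basis (F : comPzRingType) (A : lmodType F) (p : nat)
    (t : 'I_p -> A) (ts : 'I_p -> qform A 1) : Prop :=
  forall a b, ev1 (ts a) (t b) = (a == b)%:R.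

(* Main.v *)
Require Import Defs.
From mathcomp Require Import all_boot all_fingroup all_algebra.

Set Implicit Arguments.
Unset Strict Implicit.
Unset Printing Implicit Defensive.

Import GRing.Theory.
Local Open Scope ring_scope.

(** Both sides are [2]-forms, and a [2]-form is determined by its values on the
    pairs [(t i, t j)] since the [t i] span [A] ([form2_ext_span]). On such a
    pair the two anchor terms of [ext_d] differentiate the constants
    [(a == j)%:R] and [(a == i)%:R], on which every derivation vanishes, so that
    only minus the [a]-th coordinate of [[t i, t j]], namely [- L a i j],
    remains ([ext_d_dual_basis]). On the other side [wedge (ts b) (ts c)] is the
    difference of the indicators of [(b, c) = (i, j)] and [(b, c) = (j, i)], so
    the sum over [b < c] keeps [L a i j] if [i < j] and [- L a j i] if [j < i]
    ([sum_wedge_dual_basis]). Antisymmetry of [L a] in its two arguments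
    identifies the latter with [L a i j]. The diagonal pairs must be treated on their own:
    where [2] is not invertible, an antisymmetric form need not vanish on
    [(u, u)], so for [i = j] it is [[t i, t i] = 0] that gives [L a i i = 0]. *)

Lemma derivation_nat (F : comPzRingType) (X : derivation F) (n : nat) :
  X n%:R = 0.
Proof.
have X0 : X 0 = 0 by apply: (addrI (X 0)); rewrite -derD !addr0.
have X1 : X 1 = 0.
  by apply: (addrI (X 1)); have := derM X 1 1; rewrite !mul1r mulr1 addr0 => <-.
by elim: n => [|n IHn] //; rewrite -natr1 derD IHn X1 addr0.
Qed.

Section Forms.
Variables (F : comPzRingType) (A : lmodType F).

Lemma ev1_sum (w : qform A 1) (I : finType) (c : I -> F) (x : I -> A) :
  ev1 w (\sum_i c i *: x i) = \sum_i c i * ev1 w (x i).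
Proof.
elim/big_rec2: _ => [|i y u _ <-]; first exact: ev1_0.
by rewrite ev1P.
Qed.

Lemma ev2C (w : qform A 2) (u v : A) : ev2 w v u = - ev2 w u v.
Proof.
(* the sign is that of the transposition [tperm ord0 ord_max] *)
rewrite -mulN1r -(expr1 (-1)) -[1%N]/(nat_of_bool true).
rewrite -[true](odd_tperm (ord0 : 'I_2) ord_max) -form_perm; congr (form_fun w _).
apply: eq_from_tnth => i; rewrite tnth_mktuple.
by case: i => [[|[|//]] lti]; [rewrite (_ : Ordinal _ = ord0) ?tpermL |
  rewrite (_ : Ordinal _ = ord_max) ?tpermR]; try exact: val_inj.
Qed.

Lemma ev2Pl (w : qform A 2) (a : F) (u v y : A) :
  ev2 w (a *: u + v) y = a * ev2 w u y + ev2 w v y.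
Proof.
have E x : ev2 w x y = w (set_arg [tuple 0; y] ord0 x).
  congr (form_fun w _); apply: eq_from_tnth => i; rewrite tnth_mktuple.
  by case: i => [[|[|//]] lti].
by rewrite !E formP.
Qed.

Lemma ev2_suml (w : qform A 2) (I : finType) (c : I -> F) (x : I -> A) (y : A) :
  ev2 w (\sum_i c i *: x i) y = \sum_i c i * ev2 w (x i) y.
Proof.
elim/big_rec2: _ => [|i z u _ <-]; last by rewrite ev2Pl.
by have := ev2Pl w (-1) 0 0 y; rewrite scaleN1r addNr mulN1r addNr.
Qed.

(** Linearity in the second argument comes from the first one by antisymmetry,
    hence the two passes through [ev2C]. *)
Lemma form2_ext_span (p : nat) (t : 'I_p -> A) (w z : qform A 2) :
  (forall u : A, exists c : 'I_p -> F, u = \sum_(i < p) c i *: t i) ->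
  (forall i j, ev2 w (t i) (t j) = ev2 z (t i) (t j)) -> w = z.
Proof.
move=> t_span wz; apply: qform_eq => x.
have evE (y : qform A 2) : y x = ev2 y (tnth x ord0) (tnth x ord_max).
  congr (form_fun y _); apply: eq_from_tnth => -[[|[|//]] lti];
  by congr (tnth x _); apply: val_inj.
have [c Ec] := t_span (tnth x ord0); have [d Ed] := t_span (tnth x ord_max).
rewrite !evE Ec Ed !ev2_suml; apply: eq_bigr => i _.
rewrite ev2C [in RHS]ev2C !ev2_suml; congr (_ * - _); apply: eq_bigr => j _.
by rewrite ev2C [in RHS]ev2C wz.
Qed.

Section DualBasis.
Variables (p : nat) (t : 'I_p -> A) (ts : 'I_p -> qform A 1).
Hypothesis ts_dual : is_dual_basis t ts.

(** The anchor terms vanish: they differentiate the Kronecker symbols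
    [ev1 (ts a) (t j)] and [ev1 (ts a) (t i)], which are constants. *)
Lemma ext_d_dual_basis (G : gen_lie_alg A) (a i j : 'I_p) :
  ev2 (ext_d G (ts a)) (t i) (t j) = - ev1 (ts a) (bracket G (t i) (t j)).
Proof. by rewrite ext_dE !ts_dual !derivation_nat subrr sub0r. Qed.

Lemma ev1_dual_basis_sum (a : 'I_p) (c : 'I_p -> F) :
  ev1 (ts a) (\sum_b c b *: t b) = c a.
Proof.
rewrite ev1_sum (bigD1 a) //= ts_dual eqxx mulr1 big1 ?addr0 // => b ba.
by rewrite ts_dual eq_sym (negPf ba) mulr0.
Qed.

(** For [b != d], [wedge (ts b) (ts d)] is [1] on [(t b, t d)], [-1] on
    [(t d, t b)] and [0] on all other basis pairs, so the index pairs [(i, j)]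
    and [(j, i)] contribute with opposite signs; when [i = j] the two
    contributions cancel. *)
Lemma sum_wedge_dual_basis (P : rel 'I_p) (c : 'I_p -> 'I_p -> F) (i j : 'I_p) :
  ev2 (\sum_b \sum_(d | P b d) c b d *: wedge (ts b) (ts d)) (t i) (t j) =
  c i j *+ P i j - c j i *+ P j i.
Proof.
have ev2_add : {morph (fun w : qform A 2 => ev2 w (t i) (t j)) : w z / w + z}.
  by [].
have ev2_0 : ev2 (0 : qform A 2) (t i) (t j) = 0 by [].
rewrite (big_morph _ ev2_add ev2_0).
under eq_bigr do rewrite (big_morph _ ev2_add ev2_0) big_mkcond.
(* each of the two terms of the wedge selects a single entry of [c] *)
have pick k l : \sum_b \sum_d
    (c b d *+ P b d) * ((b == k)%:R * (d == l)%:R) = c k l *+ P k l.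
  rewrite (bigD1 k) //= (bigD1 l) //= !eqxx !mulr1 !big1 ?addr0 //.
    by move=> b /negPf bk; rewrite big1 // => d _; rewrite bk mul0r mulr0.
  by move=> d /negPf ->; rewrite !mulr0.
rewrite -2!pick -sumrB; apply: eq_bigr => b _.
rewrite -sumrB; apply: eq_bigr => d _.
rewrite -mulrBr; case: (P b d); rewrite ?mulr1n ?mulr0n ?mul0r //.
change (c b d * ev2 (wedge (ts b) (ts d)) (t i) (t j) =
        c b d * ((b == i)%:R * (d == j)%:R - (b == j)%:R * (d == i)%:R)).
by rewrite wedgeE !ts_dual.
Qed.

End DualBasis.

End Forms.

Theorem theorem4p14 (F : comPzRingType) (A : lmodType F) (G : gen_lie_alg A)
    (p : nat) (t : 'I_p -> A) (ts : 'I_p -> qform A 1)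
    (L : 'I_p -> 'I_p -> 'I_p -> F)
    (t_basis : is_basis t) (ts_dual : is_dual_basis t ts)
    (L_struct : forall a b : 'I_p,
       bracket G (t a) (t b) = \sum_(c < p) L c a b *: t c) :
  forall a : 'I_p,
    ext_d G (ts a) =
    - \sum_(b < p) \sum_(c < p | (b < c)%N) L a b c *: wedge (ts b) (ts c).
Proof.
move=> a; apply: (@form2_ext_span _ _ _ t); first exact: t_basis.1.
move=> i j; rewrite (ext_d_dual_basis ts_dual).
have LE k l : ev1 (ts a) (bracket G (t k) (t l)) = L a k l.
  by rewrite L_struct (ev1_dual_basis_sum ts_dual _ (fun c => L c k l)).
set S := \sum_b _.
(* evaluation commutes with the opposite of forms by definition *)
change (- ev1 (ts a) (bracket G (t i) (t j)) = - ev2 S (t i) (t j)).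
rewrite (sum_wedge_dual_basis ts_dual (fun b c : 'I_p => (b < c)%N)).
congr (- _); case: (ltngtP i j) => [_|_|/val_inj ->].
- by rewrite LE mulr1n mulr0n subr0.
-
  (* the bracket is put in the form [(-1) *: v + 0], to which the linearity of
     [ts a] applies *)
  rewrite bracketC -scaleN1r -[X in ev1 _ X]addr0 ev1P ev1_0 addr0 LE.
  by rewrite mulN1r mulr0n sub0r.
by rewrite bracketuu ev1_0 mulr0n subrr.
Qed.
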